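(* For every finite word $w$ over $A$, there exists a unique finite sequence $(n_1,\ldots,n_k)$ (with $k\ge 0$) of Nyldon words over $A$ such that $w=n_1\cdots n_k$ and $n_1\le_{\mathrm{lex}}\cdots\le_{\mathrm{lex}}n_k$.
   Context: $A$ is a finite alphabet of cardinality at least $2$ with a total order $<$. $A^*$ is the set of finite words over $A$ (including the empty word $\varepsilon$), $|w|$ is the length of $w$. The lexicographic order $<_{\mathrm{lex}}$ on $A^*$ is the total order given by: $u<_{\mathrm{lex}}v$ if $u$ is a proper prefix of $v$, or there exist letters $i<j$ and a word $p$ such that $pi$ is a prefix of $u$ and $pj$ is a prefix of $v$; $u\le_{\mathrm{lex}}v$ means $u<_{\mathrm{lex}}v$ or $u=v$. Nyldon words are defined recursively on length: every letter (word of length $1$) is Nyldon; a word $w$ of length at least $2$ is Nyldon if and only if there is no sequence $(n_1,\ldots,n_k)$ of Nyldon words with $w=n_1\cdots n_k$, $\max\{|n_1|,\ldots,|n_k|\}<|w|$ and $n_1\le_{\mathrm{lex}}\cdots\le_{\mathrm{lex}}n_k$. The empty word is not Nyldon; it corresponds to the empty sequence ($k=0$). *)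

(* Defs.v *)
From mathcomp Require Import all_boot all_order.

Set Implicit Arguments.
Unset Strict Implicit.
Unset Printing Implicit Defensive.

Import Order.TTheory.

(* MathComp's lexicographic order on [seq A]; [lex_leP] gives the description
   in terms of prefixes. *)
Definition lex_le (d : Order.disp_t) (A : finOrderType d) : rel (seq A) :=
  fun u v => ((u : seqlexi A) <= (v : seqlexi A))%O.

Definition nondecreasing_factorization (d : Order.disp_t) (A : finOrderType d)
    (P : seq A -> Prop) (w : seq A) (ns : seq (seq A)) : Prop :=
  [/\ forall u, u \in ns -> P u,
      w = flatten ns &
      sorted (@lex_le d A) ns].

(* Recursion on the length is implemented with fuel [n]; [nyldonE] shows that
   the fuel [size w] is enough to satisfy the intended recursive equation. *)
Fixpoint nyldon_rec (d : Order.disp_t) (A : finOrderType d)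
    (n : nat) (w : seq A) : Prop :=
  if n is n'.+1 then
    size w = 1 \/
    1 < size w /\
    ~ (exists ns : seq (seq A),
         nondecreasing_factorization (@nyldon_rec d A n') w ns /\
         \max_(u <- ns) size u < size w)
  else False.

Definition nyldon (d : Order.disp_t) (A : finOrderType d) (w : seq A) : Prop :=
  nyldon_rec (size w) w.

Lemma lex_leP (d : Order.disp_t) (A : finOrderType d) (u v : seq A) :
  lex_le u v <->
  [\/ u = v,
      exists a s, v = u ++ a :: s |
      exists p i j s t, [/\ (i < j)%O, u = p ++ i :: s & v = p ++ j :: t]].
Proof.
rewrite /lex_le; split.
  elim: u v => [|x u IHu] [|y v] //=.
  - by move=> _; constructor 1.
  - by move=> _; constructor 2; exists y, v.
  rewrite Order.SeqLexiOrder.lexi_cons.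
  case: (ltgtP x y) => [ltxy|//|<-] /=.
    by move=> _; constructor 3; exists [::], x, y, u, v.
  case/IHu => [->|[a [s ->]]|[p [i [j [s [t [ltij -> ->]]]]]]].
  - by constructor 1.
  - by constructor 2; exists a, s.
  - by constructor 3; exists (x :: p), i, j, s, t.
case=> [->|[a [s ->]]|[p [i [j [s [t [ltij -> ->]]]]]]].
- exact: lexx.
- by elim: u => [|x u IHu] //=; rewrite Order.SeqLexiOrder.lexi_cons lexx.
elim: p => [|x p IHp] /=; rewrite Order.SeqLexiOrder.lexi_cons.
  by rewrite (ltW ltij) (lt_geF ltij).
by rewrite lexx.
Qed.

Lemma nyldon_recE (d : Order.disp_t) (A : finOrderType d) (n : nat)
    (w : seq A) : size w <= n -> nyldon_rec n w <-> nyldon w.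
Proof.
have step m k (v : seq A) :
    (forall u : seq A, size u < size v ->
       nyldon_rec m u <-> nyldon_rec k u) ->
    nyldon_rec m.+1 v -> nyldon_rec k.+1 v.
  move=> eqmk /= [v1|[v2 nofact]]; [by left | right; split=> //].
  case=> ns [[nsP vE ns_sorted] ns_max]; apply: nofact; exists ns; split=> //.
  split=> // u u_ns; apply/eqmk; last exact: nsP.
  exact: leq_ltn_trans (leq_bigmax_seq _ u_ns isT) ns_max.
suff stable m k (v : seq A) : size v <= m -> size v <= k ->
    nyldon_rec m v <-> nyldon_rec k v by move=> wn; apply: stable.
elim: m k v => [|m IHm] [|k] v // vm vk.
- move: vm; rewrite leqn0 size_eq0 => /eqP->.
  by split=> //= -[|[]].
- move: vk; rewrite leqn0 size_eq0 => /eqP->.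
  by split=> //= -[|[]].
split; apply: step => // u uv; last apply: iff_sym;
  by apply: IHm; rewrite -ltnS; apply: leq_trans uv _.
Qed.

Lemma nyldonE (d : Order.disp_t) (A : finOrderType d) (w : seq A) :
  nyldon w <->
  size w = 1 \/
  1 < size w /\
  ~ (exists ns : seq (seq A),
       nondecreasing_factorization (@nyldon d A) w ns /\
       \max_(u <- ns) size u < size w).
Proof.
apply: iff_trans (iff_sym (nyldon_recE (leqnSn (size w)))) _ => /=.
have eqf ns : \max_(u <- ns) size u < size w ->
    nondecreasing_factorization (@nyldon_rec d A (size w)) w ns <->
    nondecreasing_factorization (@nyldon d A) w ns.
  move=> ns_max; split=> -[nsP wE ns_sorted]; split=> // u u_ns;
    have uw := leq_ltn_trans (leq_bigmax_seq _ u_ns isT) ns_max;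
    by apply/(nyldon_recE (ltnW uw)); apply: nsP.
split=> -[w1|[w2 nofact]]; try (by left); right; split=> // -[ns [nsP ns_max]];
  by apply: nofact; exists ns; split=> //; apply/eqf.
Qed.

(* Main.v *)
Require Import Defs.
From mathcomp Require Import all_boot all_order.
From Stdlib Require Import Classical.

(** Existence is built into the definition: a word of length at least [2] that
is not Nyldon has a nondecreasing Nyldon factorization because that is what not
being Nyldon means ([nyldon_factorization_exists]).

Uniqueness rests on the fact that a Nyldon word is lexicographically at least
as large as each of its Nyldon suffixes ([nyldon_suffix_le]). When the factors
of a factorization have this property, its last factor is the longest Nyldon
suffix of the product ([last_factor_longest]): a longer Nyldon suffix would be
[v ++ flatten ms], where [v] is a nonempty suffix of some factor [a] and [ms]
is the nonempty list of the factors after [a]; the last Nyldon factor of [v] is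
at most [a], so a factorization of [v] followed by [ms] would be a nontrivial
factorization of a Nyldon word. Hence the last factor is determined by the
word, and uniqueness follows by removing it and iterating.

The suffix property is proved by induction on the Nyldon word [w], and then
from its longest suffixes down to its shortest ones. Write [w = p ++ s] and let
[u] be the last factor of [p]. As [w] is Nyldon, [u <= s] fails. If [p = u],
then [s <= u <= w] because [u] is a prefix of [w]. Otherwise [u ++ s] is
shorter than [w], so by induction the last factor [m] of [u ++ s] is its longest
Nyldon suffix. Either [m] is longer than [s], and then [s <= m <= w] by
induction, or [m = s], and then removing [m] leaves a factorization of the
Nyldon word [u], which forces [u <= s]. *)

Set Implicit Arguments.
Unset Strict Implicit.
Unset Printing Implicit Defensive.

Section Nyldon.

Variables (d : Order.disp_t) (A : finOrderType d).
Implicit Types (u v w p s a m : seq A) (ns ms us vs : seq (seq A)).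

Local Notation le := (@lex_le d A).
Local Notation fact := (nondecreasing_factorization (@nyldon d A)).

Lemma lex_le_refl : reflexive le.
Proof. by move=> u; apply: Order.le_refl. Qed.

Lemma lex_le_trans : transitive le.
Proof. by move=> v u w; apply: Order.le_trans. Qed.

Lemma lex_le_total : total le.
Proof. by move=> u v; apply: Order.le_total. Qed.

Lemma lex_le_prefix u v : le u (u ++ v).
Proof.
case: v => [|x v]; first by rewrite cats0 lex_le_refl.
by apply/lex_leP; constructor 2; exists x, v.
Qed.

Lemma nyldon_size_gt0 w : nyldon w -> 0 < size w.
Proof. by case/nyldonE => [->|[/ltnW]]. Qed.

Lemma factorization1 w : nyldon w -> fact w [:: w].
Proof.
move=> nw; split=> //=; last by rewrite cats0.
by move=> u; rewrite inE => /eqP->.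
Qed.

(** The default value [[::]] is the least word, so that the order condition
constrains nothing when [us] is empty. *)
Lemma factorization_cat u v us vs :
  fact u us -> fact v vs ->
  (forall b, b \in vs -> le (last [::] us) b) -> fact (u ++ v) (us ++ vs).
Proof.
move=> [usP -> us_sorted] [vsP -> vs_sorted] us_vs; split.
- by move=> x; rewrite mem_cat => /orP[/usP|/vsP].
- by rewrite flatten_cat.
case: us us_sorted us_vs {usP} => [|x us] //= us_sorted us_vs.
rewrite cat_path us_sorted path_min_sorted //.
by apply/allP => b /us_vs.
Qed.

Lemma factorization_catr us vs :
  fact (flatten (us ++ vs)) (us ++ vs) -> fact (flatten vs) vs.
Proof.
move=> [nsP _ /cat_sorted2[_ vs_sorted]]; split=> // u u_vs.
by apply: nsP; rewrite mem_cat u_vs orbT.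
Qed.

Lemma factorization_catl us vs :
  fact (flatten (us ++ vs)) (us ++ vs) -> fact (flatten us) us.
Proof.
move=> [nsP _ /cat_sorted2[us_sorted _]]; split=> // u u_us.
by apply: nsP; rewrite mem_cat u_us.
Qed.

Lemma factorization_nil ns : fact [::] ns -> ns = [::].
Proof.
case: ns => [|a ns] // [nsP /(congr1 size) /= E _].
have := nyldon_size_gt0 (nsP a (mem_head _ _)).
by move: E; rewrite size_cat; case: (size a).
Qed.

(** The definition only excludes factorizations into strictly shorter words.
As Nyldon words are nonempty, the one remaining factorization is the trivial
one. *)
Lemma nyldon_factorization_trivial w ns : nyldon w -> fact w ns -> ns = [:: w].
Proof.
move=> nw fw; have w_gt0 := nyldon_size_gt0 nw.
case: ns fw => [|a [|b ns]] fw.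
- by case: fw w_gt0 => _ ->.
- by case: fw => _ /= ->; rewrite cats0.
have max_lt : \max_(u <- a :: b :: ns) size u < size w.
  case: (fw) => nsP wE _.
  have a_gt0 : 0 < size a by apply/nyldon_size_gt0/nsP/mem_head.
  have b_gt0 : 0 < size b.
    by apply/nyldon_size_gt0/nsP; rewrite !inE eqxx orbT.
  have max_le : \max_(u <- ns) size u <= size (flatten ns).
    elim: ns {fw nsP wE} => [|c ns IHns]; first by rewrite big_nil.
    rewrite big_cons /= size_cat geq_max leq_addr.
    exact: leq_trans IHns (leq_addl _ _).
  rewrite !big_cons wE /= !size_cat !gtn_max.
  rewrite -{1}[size a]addn0 ltn_add2l addn_gt0 b_gt0 /=.
  apply/andP; split.
    by rewrite -[X in X < _]add0n -addSn leq_add // leq_addr.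
  apply: leq_ltn_trans max_le _.
  by rewrite addnA -{1}[size (flatten ns)]add0n ltn_add2r addn_gt0 a_gt0.
case/nyldonE: nw => [w1|[_ []]]; last by exists (a :: b :: ns).
move: max_lt; rewrite w1 big_cons gtn_max => /andP[+ _].
case: fw => nsP _ _; have := nyldon_size_gt0 (nsP a (mem_head _ _)).
by case: (size a).
Qed.

Lemma nyldon_factorization_exists w : exists ns, fact w ns.
Proof.
case: (posnP (size w)) => [/size0nil->|w_gt0]; first by exists [::].
have [nw|not_nw] := classic (nyldon w).
  by exists [:: w]; apply: factorization1.
case: (classic (exists ns, fact w ns)) => // no_fact.
case: not_nw; apply/nyldonE.
move: w_gt0; rewrite leq_eqVlt => /orP[/eqP <-|w_gt1]; first by left.
by right; split=> // -[ns [fw _]]; apply: no_fact; exists ns.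
Qed.

Lemma nyldon_factorization_rcons w : 0 < size w ->
  exists us u, fact w (rcons us u).
Proof.
move=> w_gt0; case: (nyldon_factorization_exists w) => ns.
case/lastP: ns => [|us u fw]; first by move=> [_ wE _]; rewrite wE in w_gt0.
by exists us, u.
Qed.

Lemma cat_eq_prefix (u1 u2 v1 v2 : seq A) :
  u1 ++ v1 = u2 ++ v2 -> size u1 <= size u2 ->
  exists t, u2 = u1 ++ t /\ v1 = t ++ v2.
Proof.
elim: u1 u2 => [|x u1 IH] [|y u2] //=; try by [exists [::] | exists (y :: u2)].
by case=> <- /IH E /E[t [-> ->]]; exists t.
Qed.

(** The suffix property is a hypothesis on the factors only, because the lemma
serves in the inductive proof of that property. *)
Lemma last_factor_longest ms p s :
  (forall a q t, a \in ms -> a = q ++ t -> nyldon t -> le t a) ->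
  fact (p ++ s) ms -> nyldon s -> size s <= size (last [::] ms).
Proof.
elim: ms p => [|a ms IHms] p suffix_le fps ns.
  have [_ /(congr1 size)/eqP + _] := fps.
  rewrite size_cat addn_eq0 => /andP[_ /eqP s0].
  by have := nyldon_size_gt0 ns; rewrite s0.
have [msP psE ms_sorted] := fps.
have fms : fact (flatten ms) ms.
  by apply: (@factorization_catr [:: a]); rewrite -psE.
case: (leqP (size a) (size p)) => [ap|pa].
  have [t [_ fE]] := cat_eq_prefix (esym psE) ap.
  have := IHms t; rewrite -fE => /(_ _ fms ns).
  case: ms {IHms msP psE ms_sorted fps} fE fms suffix_le => [|b ms] fE fms sle IH.
    by apply: leq_trans (IH _) _.
  apply: IH => c q r c_ms.
  by apply: sle; rewrite inE c_ms orbT.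
(* The cut falls inside [a]: it leaves the nonempty suffix [v] of [a]. *)
have [v [aE sE]] := cat_eq_prefix psE (ltnW pa).
have v_gt0 : 0 < size v.
  by move: pa; rewrite aE size_cat -{1}[size p]addn0 ltn_add2l.
have [vs [b fv]] := nyldon_factorization_rcons v_gt0.
have ba : le b a.
  have [vsP vE _] := fv.
  apply: (suffix_le _ (p ++ flatten vs)); first exact: mem_head.
    by rewrite aE vE flatten_rcons catA.
  by apply: vsP; rewrite mem_rcons mem_head.
have fs : fact s (rcons vs b ++ ms).
  rewrite sE; apply: factorization_cat => // c c_ms; rewrite last_rcons.
  apply: lex_le_trans ba _.
  by move/(order_path_min lex_le_trans)/allP: ms_sorted => /(_ c c_ms).
have := nyldon_factorization_trivial ns fs.
case: ms sE {IHms suffix_le fps msP psE ms_sorted fms fs} => [|c ms] sE /=.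
  by move: sE; rewrite /= cats0 => -> _; rewrite aE size_cat leq_addl.
by move/(congr1 size); rewrite size_cat size_rcons /= addSn addnS.
Qed.

Lemma nyldon_suffix_le p s : nyldon (p ++ s) -> nyldon s -> le s (p ++ s).
Proof.
have [n] := ubnP (size (p ++ s)); elim: n p s => // n IHn p s.
have [k] := ubnP (size p); elim: k p s => // k IHk p s.
rewrite !ltnS => pk psn nps ns.
have [/size0nil->|p_gt0] := posnP (size p); first exact: lex_le_refl.
have [us [u fp]] := nyldon_factorization_rcons p_gt0.
have [usP pE _] := fp.
have nu : nyldon u by apply: usP; rewrite mem_rcons mem_head.
have not_us : ~ le u s.
  move=> us_le; have fps : fact (p ++ s) (rcons us u ++ [:: s]).
    apply: factorization_cat (factorization1 ns) _ => // b.
    by rewrite inE last_rcons => /eqP->.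
  have /(congr1 size) := nyldon_factorization_trivial nps fps.
  by rewrite size_cat size_rcons addn1.
have su : le s u by case/orP: (lex_le_total s u) => // /not_us.
move: pE; rewrite flatten_rcons => pE.
have [q0|q_gt0] := posnP (size (flatten us)).
  move: pE; rewrite (size0nil q0) => ->.
  exact: lex_le_trans su (lex_le_prefix _ _).
have u_gt0 := nyldon_size_gt0 nu.
have us_lt : size (u ++ s) < size (p ++ s).
  by rewrite pE -catA [X in _ < X]size_cat -{1}[size _]add0n ltn_add2r.
have us_gt0 : 0 < size (u ++ s) by rewrite size_cat addn_gt0 u_gt0.
have [ms [m fus]] := nyldon_factorization_rcons us_gt0.
have [msP usE ms_sorted] := fus.
have nm : nyldon m by apply: msP; rewrite mem_rcons mem_head.
have sm : size s <= size m.
  rewrite -(last_rcons [::] ms m); apply: last_factor_longest fus ns.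
  move=> a q t a_ms aE nt; rewrite aE; apply: IHn => //; rewrite -aE.
    apply: leq_trans psn; apply: leq_ltn_trans us_lt.
    rewrite usE; elim: (rcons ms m) a_ms => //= b l IHl.
    rewrite inE size_cat => /orP[/eqP->|/IHl]; first exact: leq_addr.
    by move/leq_trans; apply; apply: leq_addl.
  exact: msP.
rewrite flatten_rcons in usE.
have msu : size (flatten ms) <= size u.
  by rewrite -(leq_add2r (size s)) -[leqRHS]size_cat usE size_cat leq_add2l.
have [t [uE mE]] := cat_eq_prefix (esym usE) msu.
have [t0|t_gt0] := posnP (size t).
  move: uE mE; rewrite (size0nil t0) cats0 /= => uE mE.
  have fu : fact u ms.
    rewrite uE; apply: (@factorization_catl _ [:: m]).
    by rewrite cats1 flatten_rcons -usE.
  case: not_us; rewrite -mE.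
  by move: ms_sorted; rewrite (nyldon_factorization_trivial nu fu) /= andbT.
have wE : p ++ s = (flatten us ++ flatten ms) ++ m.
  by rewrite pE -!catA usE.
apply: (@lex_le_trans m).
  rewrite mE; apply: IHn => //; last by rewrite -mE.
  rewrite -mE; apply: leq_trans psn.
  by rewrite wE size_cat -{1}[size m]add0n ltn_add2r size_cat addn_gt0 q_gt0.
rewrite wE; apply: IHk; rewrite -?wE //.
apply: leq_trans pk.
rewrite pE uE !size_cat ltn_add2l.
by rewrite -{1}[size (flatten ms)]addn0 ltn_add2l.
Qed.

Lemma nyldon_factorization_unique w ns ms : fact w ns -> fact w ms -> ns = ms.
Proof.
have last_le p s l : fact (p ++ s) l -> nyldon s -> size s <= size (last [::] l).
  move=> fl; apply: last_factor_longest (fl) => a q t a_l aE nt.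
  by rewrite aE; apply: nyldon_suffix_le; rewrite // -aE; case: fl => lP _ _; apply: lP.
elim/last_ind: ns w ms => [|ns a IHns] w ms.
  by move=> [_ -> _] /factorization_nil.
case/lastP: ms => [|ms b] fns fms.
  by have [_ wE _] := fms; move: fns; rewrite wE => /factorization_nil.
have [nsP nsE _] := fns; have [msP msE _] := fms.
have na : nyldon a by apply: nsP; rewrite mem_rcons mem_head.
have nb : nyldon b by apply: msP; rewrite mem_rcons mem_head.
rewrite flatten_rcons in nsE; rewrite flatten_rcons in msE.
have ab : size a = size b.
  apply/eqP; rewrite eqn_leq; apply/andP; split.
    by rewrite -(last_rcons [::] ms b); apply: (last_le (flatten ns)) na; rewrite -nsE.
  by rewrite -(last_rcons [::] ns a); apply: (last_le (flatten ms)) nb; rewrite -msE.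
have /eqP := etrans (esym nsE) msE.
rewrite eqseq_cat; last first.
  by apply/eqP; rewrite -(eqn_add2r (size a)) {2}ab -!size_cat -nsE -msE.
case/andP=> /eqP flat_eq /eqP ->; congr rcons.
apply: (IHns (flatten ns)).
  by apply: (@factorization_catl _ [:: a]); rewrite cats1 flatten_rcons -nsE.
rewrite flat_eq.
by apply: (@factorization_catl _ [:: b]); rewrite cats1 flatten_rcons -msE.
Qed.

End Nyldon.

Theorem theorem16 (d : Order.disp_t) (A : finOrderType d) (hA : 1 < #|A|)
    (w : seq A) :
  exists! ns : seq (seq A),
    [/\ forall n : seq A, n \in ns -> nyldon n,
        w = flatten ns &
        sorted (@lex_le d A) ns].
Proof.
have [ns fns] := nyldon_factorization_exists w.
by exists ns; split=> // ms; apply: nyldon_factorization_unique.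
Qed.
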